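(* For every real $\alpha>0$ there exist constants $c,C>0$ such that the following holds for all large enough integers $n$. Let $G_{\alpha}$ be a graph on $n$ vertices with $\delta(G_{\alpha})\geq \alpha n$, let $b\leq cn$ be a positive integer, and let $p \geq \frac{Cb}{n}$. Then asymptotically almost surely the following holds: in the $(1:b)$ Waiter-Client game played on the edges of $G_{\alpha}\cup G_{n,p}$, Waiter has a strategy to force Client to occupy a Hamilton cycle.
   Context: A $(1:b)$ Waiter-Client game on a board $X$ with winning sets $\mathcal{F}$: in every round Waiter picks $b+1$ previously unchosen elements of $X$ (possibly fewer in the last round) and offers them to Client; Client claims one of them (in a last round with only one element offered, nothing need be claimed by Client) and the rest go to Waiter. Waiter wins if Client claims all elements of some $F\in\mathcal{F}$. $G_{n,p}$ is the binomial random graph on the vertex set of $G_\alpha$; $G_\alpha\cup G_{n,p}$ is the union of edge sets. A.a.s. means with probability tending to $1$ as $n\to\infty$. *)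

(* Defs.v *)
From HB Require Import structures.
From mathcomp Require Import all_boot all_order all_algebra.
From mathcomp Require Import all_classical all_reals all_analysis.

Set Implicit Arguments.
Unset Strict Implicit.
Unset Printing Implicit Defensive.

Import Order.TTheory GRing.Theory Num.Theory.
Import numFieldNormedType.Exports.

(* A simple graph on the vertex set [T] is a set of edges [G : {set edge T}];
   since edges are two-element sets, no further condition is needed. *)
Definition edge (T : finType) : Type := {e : {set T} | #|e| == 2%N}.
HB.instance Definition _ (T : finType) := SubFinite.on (edge T).

Section Graphs.
Variable T : finType.
Implicit Types G F : {set edge T}.

Definition degree G (v : T) : nat := #|[set e in G | v \in val e]|.

(* The default value [#|T|] exceeds every degree, so it is attained only when
   there is no vertex at all. *)
Definition min_degree G : nat := \big[minn/#|T|]_(v : T) degree G v.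

Definition cycle_edges (s : seq T) : {set edge T} :=
  [set e : edge T | [exists x in s, val e == [set x; next s x]]].

(* Duplicate-free tuples of length [#|T|] are the cyclic orderings of all the
   vertices. *)
Definition hamilton_cycles G : {set {set edge T}} :=
  [set F : {set edge T} | (F \subset G) &&
     [exists s : #|T|.-tuple T,
        [&& 2 < #|T|, uniq s & F == cycle_edges s]]].

End Graphs.

Section WaiterClient.
Variable T : finType.

(* The set offered by Waiter and the element claimed by Client, if any. *)
Definition round : Type := ({set T} * option T)%type.

(* Histories list the rounds played so far, most recent round first. *)
Implicit Types (X U Q : {set T}) (h : seq round).

Definition free X h : {set T} := X :\: \bigcup_(r <- h) r.1.

Definition client_set h : {set T} := [set x | Some x \in map snd h].

(* The whole of [U] is offered when fewer than [b + 1] elements are free. *)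
Definition legal_offer (b : nat) U Q : bool :=
  (Q \subset U) && (#|Q| == minn b.+1 #|U|).

(* Client may decline only a single element offered in the last round. *)
Definition legal_reply U Q (o : option T) : bool :=
  if o is Some x then x \in Q else (Q == U) && (#|Q| == 1%N).

Inductive play X (sigma : seq round -> {set T}) : seq round -> Prop :=
| play_start : play X sigma [::]
| play_round h (o : option T) :
    play X sigma h -> free X h != finset.set0 ->
    legal_reply (free X h) (sigma h) o ->
    play X sigma ((sigma h, o) :: h).

Definition waiter_strategy (b : nat) X (sigma : seq round -> {set T}) : Prop :=
  forall h, play X sigma h -> free X h != finset.set0 ->
    legal_offer b (free X h) (sigma h).

Definition waiter_wins (b : nat) X (W : {set {set T}}) : Prop :=
  exists2 sigma, waiter_strategy b X sigma &
    forall h, play X sigma h -> free X h = finset.set0 ->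
      exists2 F, F \in W & F \subset client_set h.

End WaiterClient.

Local Open Scope ring_scope.

(* Probability that the binomial random graph on [T] with edge probability [p]
   has the property [P]. *)
Definition Gnp_prob (R : realType) (T : finType) (p : R)
    (P : {set edge T} -> Prop) : R :=
  \sum_(H : {set edge T} | `[< P H >]) p ^+ #|H| * (1 - p) ^+ #|finset.setC H|.

(* Main.v *)
Require Import Defs.
From mathcomp Require Import all_boot all_order all_algebra ring lra zify.
From mathcomp Require Import boolp.

Set Implicit Arguments.
Unset Strict Implicit.
Unset Printing Implicit Defensive.

(* Waiter first makes Client's graph an expander, then adds boosters.

   In five rounds per vertex v, Waiter offers b + 1 edges of G at v, choosing
   their other ends by derandomisation: the potential is the expected number of
   pairs (S, Z) with |Z| = 3|S| and N(S) inside Z if these ends were random, and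
   by Markov's inequality at most half of the candidate ends increase it. So at
   the end 2|S| < |N(S) \ S| for all small nonempty sets S of vertices.

   By Posa's lemma an expander that is not Hamiltonian has quadratically many
   boosters: pairs that close a Hamilton cycle or lengthen the longest path.
   Waiter exposes the random graph only at boosters of Client's current graph,
   and offers them as soon as b + 1 are found; n such rounds suffice. Against
   fixed answers of Client the exposed pairs are independent, and the union
   bound over all (b + 1) ^ O(n) sequences of answers is beaten by the
   probability exp (- Omega(p n ^ 2)) of finding too few boosters. *)

(** * Posa rotations and boosters *)

Section Neighbours.
Variable T : eqType.
Implicit Types (s : seq T) (u v w : T).

Fixpoint nb s u w : bool :=
  if s is a :: s' then
    (if s' is b :: _ then (u == a) && (w == b) || (u == b) && (w == a)
     else false) || nb s' u w
  else false.

Lemma nb_cons2 a b s u w : nb [:: a, b & s] u w =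
  ((u == a) && (w == b) || (u == b) && (w == a)) || nb (b :: s) u w.
Proof. by []. Qed.

Lemma nb_cat s1 a b s2 u w :
  nb (rcons s1 a ++ b :: s2) u w =
  [|| nb (rcons s1 a) u w, nb (b :: s2) u w,
      (u == a) && (w == b) | (u == b) && (w == a)].
Proof.
elim: s1 => [|c s1 IH]; first by rewrite nb_cons2 orbC.
case: s1 IH => [|d s1] IH.
  rewrite -[rcons [:: c] a ++ _]/[:: c, a, b & s2] -[rcons [:: c] a]/[:: c; a].
  by rewrite !nb_cons2 [nb [:: a] u w]/= orbF; congr orb; exact: orbC.
by rewrite !rcons_cons !cat_cons !nb_cons2 -!cat_cons -!rcons_cons IH !orbA.
Qed.

Lemma nb_rev s u w : nb (rev s) u w = nb s u w.
Proof.
elim: s => [//|a [|b s] IH] //.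
rewrite !rev_cons -[LHS]/(nb (rcons (rcons (rev s) b) a) u w) -[X in nb X](cats1 _ a).
rewrite nb_cat -rev_cons IH nb_cons2 [nb [:: a] u w]/= orFb orbC.
by rewrite [X in X || _ = _]orbC.
Qed.

Lemma nb_split s u w : nb s u w ->
  exists s1 s2, s = s1 ++ [:: u, w & s2] \/ s = s1 ++ [:: w, u & s2].
Proof.
elim: s => [//|a [|b s] IH] //; rewrite nb_cons2.
case/orP => [/orP[] /andP[/eqP-> /eqP->]|/IH [s1 [s2 E]]].
- by exists [::], s; left.
- by exists [::], s; right.
by exists (a :: s1), s2; case: E => ->; [left|right].
Qed.

(** Without repetitions an entry has at most one successor and one predecessor. These two functions
    of [w] give the factor 2 in Posa's lemma. *)
Lemma nb_nth x0 s u w : uniq s -> nb s u w ->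
  u = nth x0 s (index w s).+1 \/ u = nth x0 s (index w s).-1.
Proof.
move=> us /nb_split [s1 [s2 [] E]]; move: us; rewrite {}E cat_uniq => /and3P[_ h us].
  right; have [w1 wu] : w \notin s1 /\ u != w.
    split; first apply: (contra _ h) => w1.
      by apply/hasP; exists w; rewrite // !inE eqxx orbT.
    by move: us; rewrite /= inE negb_or -andbA => /and3P[].
  rewrite index_cat (negbTE w1) /= (negbTE wu) eqxx addn1 /=.
  by rewrite nth_cat ltnn subnn.
left; have w1 : w \notin s1.
  by apply: (contra _ h) => w1; apply/hasP; exists w; rewrite // !inE eqxx.
by rewrite index_cat (negbTE w1) /= eqxx addn0 nth_cat ltnNge leqnSn /= subSnn.
Qed.

(** The reversal trades the pair [v], [z] for the pair [v], [last z q2] and keeps all other pairs,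
    so only these three vertices change neighbours. *)
Lemma nb_flip q1 v z q2 u w :
  u != v -> u != z -> u != last z q2 ->
  nb (q1 ++ v :: rev (z :: q2)) u w -> nb (q1 ++ v :: z :: q2) u w.
Proof.
move=> uv uz ul.
have [y [t Et]] : exists y t, rev (z :: q2) = y :: t /\ y = last z q2.
  rewrite lastI rev_rcons; by exists (last z q2), (rev (belast z q2)).
case: Et => Et Ey; rewrite Et -!(cat_rcons v q1) !nb_cat -Et nb_rev Ey.
by rewrite (negbTE uv) (negbTE ul) (negbTE uz) /= !orbF.
Qed.

End Neighbours.

Section Posa.
Variables (T : finType) (e : rel T).
Hypothesis e_sym : symmetric e.
Implicit Types (s p q : seq T) (x y v w : T) (S : {set T}).

Definition graph_path s := uniq s && sorted e s.

(** Posa rotations with the first vertex fixed: the edge from [v] to the last vertex replaces the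
    one from [v] to [z], and [z] becomes the new end. *)
Inductive rotated p : seq T -> Prop :=
| Rotated0 : rotated p p
| RotatedS q1 v z q2 : rotated p (q1 ++ v :: z :: q2) -> e v (last z q2) ->
    rotated p (q1 ++ v :: rev (z :: q2)).

Lemma sorted_cat2 s1 a b s2 : sorted e (rcons s1 a ++ b :: s2) =
  [&& sorted e (rcons s1 a), e a b & sorted e (b :: s2)].
Proof.
case: s1 => [|c s1] //=.
by rewrite cat_path last_rcons.
Qed.

Lemma sorted_revE s : sorted e (rev s) = sorted e s.
Proof. by rewrite rev_sorted; apply: eq_sorted => x y; rewrite e_sym. Qed.

Lemma rotated_path p q : rotated p q -> graph_path p ->
  [/\ graph_path q, perm_eq q p & forall x0, head x0 q = head x0 p].
Proof.
elim=> [|q1 v z q2 _ IH evl] // /IH [] /andP[uq sq] pq hq {IH}.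
have pq' : perm_eq (q1 ++ v :: rev (z :: q2)) (q1 ++ v :: z :: q2).
  by rewrite perm_cat2l perm_cons perm_rev.
split; last 2 first.
- exact: perm_trans pq' pq.
- by move=> x0; rewrite -hq; case: (q1).
rewrite /graph_path (perm_uniq pq') uq /=.
have [y [t [Et Ey]]] : exists y t, rev (z :: q2) = y :: t /\ y = last z q2.
  rewrite lastI rev_rcons; by exists (last z q2), (rev (belast z q2)).
move: sq; rewrite Et -!(cat_rcons v q1) !sorted_cat2 => /and3P[-> _ sz] /=.
by rewrite Ey evl -[path e _ t]/(sorted e (last z q2 :: t)) -Ey -Et sorted_revE.
Qed.

Definition endset p : {set T} :=
  [set y | `[< exists q', rotated p (rcons q' y) >] ].

Lemma endsetP p y : reflect (exists q', rotated p (rcons q' y)) (y \in endset p).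
Proof. by rewrite inE; apply: asboolP. Qed.

(** Both [z] and [last z q2] are ends of rotated paths, so a rotation changes the neighbours of a
    vertex outside [endset p] only if this vertex is the pivot. A pivot loses [z], which by
    induction is its neighbour on [p] and yet an end, against the assumption. *)
Lemma rotated_nb p q : graph_path p -> rotated p q ->
  forall v, v \notin endset p ->
    (forall w, nb p v w -> w \notin endset p) ->
    forall w, nb q v w -> nb p v w.
Proof.
move=> gp; elim=> [//|q1 v z q2 rq IH evl] u uE uN w nbw.
have yE : last z q2 \in endset p.
  apply/endsetP; exists (q1 ++ v :: belast z q2).
  by rewrite rcons_cat rcons_cons -lastI.
have zE : z \in endset p.
  apply/endsetP; exists (q1 ++ v :: rev q2).
  by rewrite rcons_cat rcons_cons -rev_cons; apply: RotatedS.
apply: (IH u uE uN); apply: nb_flip nbw.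
- apply/eqP => uv; have : z \notin endset p.
    apply: (uN); apply: (IH _ uE uN); rewrite uv.
    by rewrite -(cat_rcons _ q1) nb_cat !eqxx !orbT.
  by rewrite zE.
- by apply: contraNneq uE => ->.
- by apply: contraNneq uE => ->.
Qed.

Definition nbhd S : {set T} := [set y | [exists x in S, e x y]].

(* Posa's lemma: [v] adjacent to an end [y] of a rotated path keeps a path
   edge to some [z]; rotating at [v] makes [z] an end, and if no neighbour of
   [v] on [p] were an end, no edge of [p] at [v] would ever have been broken,
   so that [z] itself would be such a neighbour. *)
Lemma posa p : graph_path p -> p != [::] ->
  (forall q y, rotated p (rcons q y) -> forall v, e y v -> v \in p) ->
  #|nbhd (endset p) :\: endset p| <= 2 * #|endset p|.
Proof.
move=> gp p0 maxp.
have x0 : T by case: p p0 {gp maxp}.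
pose f w := nth x0 p (index w p).+1; pose g w := nth x0 p (index w p).-1.
have sub : nbhd (endset p) :\: endset p \subset (f @: endset p) :|: (g @: endset p).
  apply/subsetP => v; rewrite inE => /andP[vE]; rewrite inE => /existsP[y /andP[yE eyv]].
  have [q rq] := endsetP _ _ yE.
  have vp := maxp _ _ rq _ eyv.
  have [gq pq _] := rotated_path rq gp.
  have vq : v \in rcons q y by rewrite (perm_mem pq).
  have [w nbw wE] : exists2 w, nb p v w & w \in endset p.
    apply/not_exists2P => H.
    have uN w : nb p v w -> w \notin endset p.
      by move=> nbw; apply/negP => wE; case: (H w).
    have vq' : v \in q.
      move: vq; rewrite mem_rcons inE => /orP[/eqP vy|//].
      by rewrite vy yE in vE.
    case/splitPr: vq' rq => [q1 q2]; rewrite rcons_cat rcons_cons => rq.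
    have [z [t [Et Ey]]] : exists z t, rcons q2 y = z :: t /\ last z t = y.
      case: (q2) => [|z t]; first by exists y, [::].
      by exists z, (rcons t y); rewrite last_rcons.
    rewrite {}Et in rq.
    have zE : z \in endset p.
      apply/endsetP; exists (q1 ++ v :: rev t).
      rewrite rcons_cat rcons_cons -rev_cons; apply: RotatedS => //.
      by rewrite Ey e_sym.
    have nbz : nb p v z.
      apply: (rotated_nb gp rq vE uN).
      by rewrite -(cat_rcons _ q1) nb_cat !eqxx !orbT.
    by have := uN _ nbz; rewrite zE.
  have up : uniq p by case/andP: gp.
  by rewrite inE; case: (nb_nth x0 up nbw) => ->; apply/orP; [left|right]; apply: imset_f.
apply: leq_trans (subset_leq_card sub) _; apply: leq_trans (leq_card_setU _ _) _.
by rewrite mul2n -addnn leq_add // leq_imset_card.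
Qed.

(** Expansion that contradicts the inequality of Posa's lemma for every nonempty set of at most [m]
    vertices. *)
Definition expander m :=
  forall S, 0 < #|S| <= m -> 2 * #|S| < #|nbhd S :\: S|.

Definition has_path k := exists2 s, graph_path s & size s = k.

Definition longest_path k := has_path k /\ forall j, has_path j -> j <= k.

Lemma graph_path_rev s : graph_path s -> graph_path (rev s).
Proof. by rewrite /graph_path rev_uniq sorted_revE. Qed.

(** Neighbours of an end of a rotated longest path lie on the path, else it could be lengthened. So
    Posa's lemma applies to the set of ends, and expansion forbids this for at most [m] ends. *)
Lemma longest_endset m k p : expander m -> longest_path k ->
  graph_path p -> size p = k -> 0 < k -> m < #|endset p|.
Proof.
move=> exm [_ maxk] gp sp k0; rewrite ltnNge; apply/negP => le_m.
have p0 : p != [::] by rewrite -size_eq0 sp -lt0n.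
have E0 : 0 < #|endset p|.
  apply/card_gt0P; case: (lastP p) (Rotated0 p) p0 => [//|q y] rq _.
  by exists y; apply/endsetP; exists q.
have := exm _ (introT andP (conj E0 le_m)).
rewrite ltnNge posa // => q y rq v eyv; apply/contraT => vp.
have [/andP[uq sq] pq _] := rotated_path rq gp.
have : has_path k.+1.
  exists (rcons (rcons q y) v); last by rewrite size_rcons (perm_size pq) sp.
  rewrite /graph_path rcons_uniq uq (perm_mem pq) vp /=.
  by rewrite -[rcons _ v]cats1 sorted_cat2 sq eyv.
by move/maxk; rewrite ltnn.
Qed.

End Posa.

Section Boosters.
Variable T : finType.
Implicit Types (e : rel T) (a b x y : T).

Definition add_edge e a b : rel T :=
  [rel x y | [|| e x y, (x == a) && (y == b) | (x == b) && (y == a)] ].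

Definition hamiltonian e := exists s, [/\ uniq s, size s = #|T| & cycle e s].

Definition booster e k a b :=
  hamiltonian (add_edge e a b) \/ exists2 j, k < j & has_path (add_edge e a b) j.

Lemma add_edge_old e a b x y : e x y -> add_edge e a b x y.
Proof. by move=> exy; apply/or3P; exact: Or31. Qed.

Lemma add_edge_new e a b : add_edge e a b a b.
Proof. by apply/or3P; rewrite !eqxx; exact: Or32. Qed.

Lemma add_edgeC e a b x y : add_edge e a b x y = add_edge e b a x y.
Proof. by rewrite /add_edge /= [X in _ || X]orbC. Qed.

Lemma sorted_add e a b s : sorted e s -> sorted (add_edge e a b) s.
Proof. by apply: sub_sorted => x y; apply: add_edge_old. Qed.

(** Rotate a longest path to an end [a], reverse it, and rotate with [a] fixed to reach many ends
    [b]. The pair [a], [b] closes a cycle on the vertices of the path; it is Hamiltonian, or an edge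
    leaving it gives a longer path. *)
Lemma many_boosters e m k : symmetric e -> 0 < m -> expander e m ->
  longest_path e k -> 0 < k ->
  exists2 A : {set T}, m < #|A| & forall a, a \in A ->
    exists2 B : {set T}, m < #|B| & forall b, b \in B -> a != b /\ booster e k a b.
Proof.
move=> e_sym m0 exm lk k0; have [[p gp sp] maxk] := lk.
pose W := ~: [set x in p].
exists (endset e p); first exact: longest_endset lk _ _ _.
move=> a /endsetP[q rq]; have [gq pq _] := rotated_path e_sym rq gp.
have sq : size (rcons q a) = k by rewrite (perm_size pq).
have aP : a \in p by rewrite -(perm_mem pq) mem_rcons inE eqxx.
(* If more than [m] vertices are off the path, joining [a] to any of them already lengthens it. *)
case: (ltnP m #|W|) => [mW|Wm].
  exists W => // b; rewrite !inE => bp; split; first by apply: contraNneq bp => <-.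
  right; exists k.+1 => //; exists (rcons (rcons q a) b); last by rewrite size_rcons sq.
  case/andP: gq => uq sq'.
  rewrite /graph_path rcons_uniq uq (perm_mem pq) bp /=.
  by rewrite -[rcons _ b]cats1 sorted_cat2 (sorted_add _ _ sq') andbT /= add_edge_new.
have gr := graph_path_rev e_sym gq.
have sr : size (rev (rcons q a)) = k by rewrite size_rev.
have mE := longest_endset e_sym exm lk gr sr k0.
exists (endset e (rev (rcons q a))) => // b /endsetP[t rt].
have [/andP[ut st] pt hd] := rotated_path e_sym rt gr.
have hta : head a (rcons t b) = a by rewrite hd rev_rcons.
have st_k : size (rcons t b) = k by rewrite (perm_size pt).
have k1 : 1 < k.
  rewrite -sr; apply: leq_ltn_trans m0 (leq_trans mE _).
  apply: leq_trans (card_size _); apply: subset_leq_card; apply/subsetP => c.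
  case/endsetP => t' rt'; have [_ pt' _] := rotated_path e_sym rt' gr.
  by rewrite -(perm_mem pt') mem_rcons inE eqxx.
have ab : a != b.
  apply/eqP => ab; subst b; case: t hta ut st_k {rt st pt hd} => [|c t] /=.
    by move=> _ _ k_1; rewrite -k_1 in k1.
  by move=> ->; rewrite mem_rcons inE eqxx.
split=> //.
have cyc : cycle (add_edge e a b) (rcons t b).
  case: t hta ut st st_k {rt pt hd} => [|c t] /=.
    by move=> _ _ _ k_1; rewrite -k_1 in k1.
  move=> -> _ st _; rewrite rcons_path last_rcons add_edgeC add_edge_new andbT.
  by have := sorted_add a b (s := a :: rcons t b) st.
have [W0|W0] := posnP #|W|.
  left; exists (rcons t b); split=> //; rewrite st_k -sp.
  have /card_uniqP <- : uniq p by case/andP: gp.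
  have := cardsC [set x in p]; rewrite -/W W0 addn0 => <-.
  by rewrite cardsE.
right; exists k.+1 => //.
(* Expansion of the small nonempty set [W] yields an edge between [W] and the cycle. Opening the
   cycle at [v] and prepending [w] gives [k.+1] vertices. *)
have := exm _ (introT andP (conj W0 Wm)) => /(leq_trans (ltn0Sn _)) /card_gt0P [v].
rewrite !inE negbK => /andP[vp /existsP[w]]; rewrite !inE => /andP[wp ewv].
have vt : v \in rcons t b by rewrite (perm_mem pt) mem_rev (perm_mem pq).
have wt : w \notin rcons t b by rewrite (perm_mem pt) mem_rev (perm_mem pq).
have [i s' Es] := rot_to vt.
exists (w :: v :: s'); last by rewrite -st_k -[in RHS](size_rot i) Es.
rewrite -(rot_cycle i) Es in cyc.
apply/andP; split; first by rewrite cons_uniq -Es rot_uniq ut mem_rot wt.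
rewrite /= add_edge_old //=.
by move: cyc; rewrite /= rcons_path => /andP[].
Qed.

End Boosters.

(** * The game *)

Section Adjacency.
Variable T : finType.
Implicit Types (C X : {set edge T}) (e f : edge T) (x y : T).

Definition adj C : rel T := [rel x y | [exists e in C, val e == [set x; y]]].

Lemma adjP C x y : reflect (exists2 e, e \in C & val e = [set x; y]) (adj C x y).
Proof. exact: 'exists_in_eqP. Qed.

Lemma adj_sym C : symmetric (adj C).
Proof. by move=> x y; rewrite /adj /= setUC. Qed.

Lemma adj_neq C x y : adj C x y -> x != y.
Proof.
case/adjP => e _ ve; have := valP e; rewrite /= ve cards2.
by case: (x != y).
Qed.

Lemma adjS C (D : {set edge T}) x y : C \subset D -> adj C x y -> adj D x y.
Proof. by move=> CD /adjP[e eC ve]; apply/adjP; exists e => //; apply: (subsetP CD). Qed.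

Lemma edge_exists x y : x != y -> exists e, val e = [set x; y].
Proof.
move=> xy; have h : #|[set x; y]| == 2 by rewrite cards2 xy.
by exists (exist _ [set x; y] h : edge T).
Qed.

Lemma set2_inj x y a b : [set a; b] = [set x; y] ->
  x = a /\ y = b \/ x = b /\ y = a.
Proof.
move=> E.
have := (set21 x y, set22 x y); rewrite -E !inE => -[xab yab].
have := (set21 a b, set22 a b); rewrite E !inE => -[axy bxy].
move: xab yab axy bxy.
by do 4![case/orP => /eqP ?]; subst; auto.
Qed.

Lemma adj_add C e a b : val e = [set a; b] -> adj (e |: C) = add_edge (adj C) a b.
Proof.
move=> ve; apply/funext => x; apply/funext => y; apply/idP/idP => [/adjP[f]|].
  rewrite in_setU1 => /orP[/eqP-> |fC]; last first.
    by move=> vf; apply: add_edge_old; apply/adjP; exists f.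
  rewrite ve => /set2_inj [] [-> ->]; first exact: add_edge_new.
  by rewrite add_edgeC add_edge_new.
case/or3P => [| |] h.
- by apply: adjS h; apply: subsetUr.
- by case/andP: h => /eqP-> /eqP->; apply/adjP; exists e; rewrite ?setU11.
- by case/andP: h => /eqP-> /eqP->; apply/adjP; exists e; rewrite ?setU11 // setUC.
Qed.

Lemma hamilton_cycle_exists C X : 2 < #|T| -> C \subset X -> hamiltonian (adj C) ->
  exists2 F, F \in hamilton_cycles X & F \subset C.
Proof.
move=> T2 CX [s [us ss cs]].
have sub : cycle_edges s \subset C.
  apply/subsetP => e; rewrite inE => /existsP[x /andP[xs /eqP ve]].
  have /adjP[f fC vf] := next_cycle cs xs.
  by have -> : e = f by apply: val_inj; rewrite vf.
exists (cycle_edges s) => //; rewrite inE (subset_trans sub CX) /=.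
by apply/existsP; exists (Tuple (introT eqP ss)); rewrite T2 us /=.
Qed.

End Adjacency.

Section Forcing.
Variables (T : finType) (b : nat) (X : {set T}) (W : {set {set T}}).
Implicit Types (U C Q F : {set T}) (h : seq (round T)).

(** A winning position as a finite game tree: [U] has been offered, [C] is Client's. Every offer has
    exactly [b.+1] elements, so for positive [b] Client has to claim one. *)
Inductive forces U C : Prop :=
| ForcesDone F : F \in W -> F \subset C -> forces U C
| ForcesOffer Q : Q \subset X :\: U -> #|Q| = b.+1 ->
    (forall x, x \in Q -> forces (U :|: Q) (x |: C)) -> forces U C.

Let used h := \bigcup_(r <- h) r.1.

Let good h Q := legal_offer b (Defs.free X h) Q /\
  ((exists2 F, F \in W & F \subset client_set h) \/
   #|Q| = b.+1 /\ forall x, x \in Q -> forces (used h :|: Q) (x |: client_set h)).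

Lemma subset_of_card (A : {set T}) k : k <= #|A| ->
  exists2 Q : {set T}, Q \subset A & #|Q| = k.
Proof.
move=> kA; exists [set x in take k (enum A)].
  by apply/subsetP => x; rewrite inE => /mem_take; rewrite mem_enum.
rewrite cardsE; have /card_uniqP -> := take_uniq k (enum_uniq A).
by rewrite size_takel // -cardE.
Qed.

Let good_exists h : forces (used h) (client_set h) -> exists Q, good h Q.
Proof.
case=> [F FW FC|Q sQ cQ fQ].
  have [Q sQ cQ] := subset_of_card (geq_minr b.+1 #|Defs.free X h|).
  by exists Q; split; [rewrite /legal_offer sQ cQ eqxx|left; exists F].
exists Q; split; last by right.
rewrite /legal_offer sQ cQ; apply/eqP/esym/minn_idPl.
by rewrite -cQ subset_leq_card.
Qed.

(** The strategy picks a good offer by choice, so [forces] is invariant along plays. Once Client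
    holds a winning set, any legal offer is good. *)
Lemma forces_wins : 0 < b -> forces set0 set0 -> waiter_wins b X W.
Proof.
move=> b0 f0.
pose sigma h := if pselect (exists Q, good h Q) is left H then projT1 (cid H) else set0.
have sigmaP h : forces (used h) (client_set h) -> good h (sigma h).
  move=> /good_exists fh; rewrite /sigma; case: pselect => // H.
  exact: projT2 (cid H).
have inv h : play X sigma h -> forces (used h) (client_set h).
  elim=> {h} [|h o ph IH nf lr].
    have -> : client_set [::] = set0 :> {set T} by apply/setP => x; rewrite !inE.
    by rewrite /used big_nil.
  have [lo gd] := sigmaP _ IH.
  rewrite /used big_cons /= setUC -/(used h).
  case: o lr => [x|] /= lr.
    have -> : client_set ((sigma h, Some x) :: h) = x |: client_set h.
      by apply/setP => y; rewrite !inE /=.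
    case: gd => [[F FW FC]|[_ fx]]; last exact: fx.
    by apply: (ForcesDone _ FW); apply: subset_trans FC (subsetUr _ _).
  have -> : client_set ((sigma h, None) :: h) = client_set h.
    by apply/setP => y; rewrite !inE /=.
  case: gd => [[F FW FC]|[c1 _]]; first exact: ForcesDone FW FC.
  by case/andP: lr => _; rewrite c1 eqSS eqn0Ngt b0.
exists sigma => [h ph _|h ph f]; first by case: (sigmaP _ (inv _ ph)).
case: (inv _ ph) => [F FW FC|Q]; first by exists F.
(* With nothing free, an offer of [b.+1] elements is impossible. *)
by rewrite -/(Defs.free X h) f subset0 => /eqP->; rewrite cards0.
Qed.

End Forcing.

(** * Counting boosters as edges *)

Section BoosterEdges.
Variable T : finType.
Implicit Types (C : {set edge T}) (e : edge T).

Definition booster_edge C k e :=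
  hamiltonian (adj (e |: C)) \/ exists2 j, k < j & has_path (adj (e |: C)) j.

Lemma expanderS C (D : {set edge T}) m :
  C \subset D -> expander (adj C) m -> expander (adj D) m.
Proof.
move=> CD exC S Sm; apply: leq_trans (exC S Sm) (subset_leq_card (setSD _ _)).
apply/subsetP => y; rewrite !inE => /existsP[x /andP[xS a]].
by apply/existsP; exists x; rewrite xS (adjS CD a).
Qed.

Lemma has_path_le (e : rel T) k : has_path e k -> k <= #|T|.
Proof. by case=> s /andP[/card_uniqP <- _] <-; apply: max_card. Qed.

Lemma longest_path_exists (e : rel T) k : has_path e k ->
  exists2 j, k <= j & longest_path e j.
Proof.
move=> hk; have ex : exists j, `[< has_path e j >] by exists k; apply/asboolP.
have ub j : `[< has_path e j >] -> j <= #|T| by move=> /asboolP; apply: has_path_le.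
case: (ex_maxnP ex ub) => j /asboolP hj maxj.
exists j; first by apply: maxj; apply/asboolP.
by split=> // i hi; apply: maxj; apply/asboolP.
Qed.

(** Count pairs of a vertex and a booster edge at it: each edge counts twice, and at least [m.+1]
    vertices have at least [m.+1] such edges. *)
Lemma card_booster_edges C m k : 0 < m -> expander (adj C) m ->
  longest_path (adj C) k -> 0 < k ->
  m.+1 ^ 2 <= 2 * #|[set e | `[< booster_edge C k e >] ]|.
Proof.
move=> m0 exm lk k0; set B := [set e | _].
have [A mA HA] := many_boosters (@adj_sym _ C) m0 exm lk k0.
have sumB : \sum_(a : T) #|[set e in B | a \in val e]| = 2 * #|B|.
  transitivity (\sum_(a : T) \sum_(e in B) (a \in val e : nat)).
    apply: eq_bigr => a _; rewrite -sum1_card big_mkcond [RHS]big_mkcond /=.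
    by apply: eq_bigr => e _; rewrite !inE; case: asboolP => //= _; case: (a \in _).
  rewrite exchange_big /= mulnC -sum_nat_const; apply: eq_bigr => e _.
  by transitivity #|val e|; [rewrite -sum1_card [RHS]big_mkcond|exact: eqP (valP e)].
rewrite -sumB.
apply: leq_trans (_ : \sum_(a in A) m.+1 <= _).
  by rewrite sum_nat_const -mulnn leq_mul2r mA orbT.
rewrite big_mkcond /=; apply: leq_sum => a _; case: ifP => // /HA[D mD HD].
pose g e := odflt a [pick b in val e :\ a].
apply: leq_trans mD (leq_trans _ (leq_imset_card g _)).
apply: subset_leq_card; apply/subsetP => b /HD[ab bst].
have [e ve] := edge_exists ab.
apply/imsetP; exists e.
  by rewrite !inE ve set21 andbT; apply/asboolP; rewrite /booster_edge (adj_add _ ve).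
rewrite /g ve; case: pickP => [c|/(_ b)]; rewrite !inE.
  by case/andP => /negPf-> /eqP->.
by rewrite eqxx orbT andbT eq_sym ab.
Qed.

End BoosterEdges.

(** * Exposing a random edge set *)

Import Order.TTheory GRing.Theory Num.Theory.
Local Open Scope ring_scope.

Section RandomSubset.
Variables (R : realFieldType) (T : finType) (p : R).
Hypothesis p01 : 0 <= p <= 1.
Implicit Types (E H : {set T}) (P : {set T} -> Prop).

(** [E] is the set of elements still to be exposed, each kept with probability [p]; exposing one
    deletes it from [E]. *)
Definition subset_prob E P : R :=
  \sum_(H : {set T} | (H \subset E) && `[< P H >]) p ^+ #|H| * (1 - p) ^+ #|E :\: H|.

Let w_ge0 E H : 0 <= p ^+ #|H| * (1 - p) ^+ #|E :\: H|.
Proof. by case/andP: p01 => p0 p1; rewrite mulr_ge0 ?exprn_ge0 ?subr_ge0. Qed.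

Lemma eq_subset_prob E P P' : (forall H, P H <-> P' H) ->
  subset_prob E P = subset_prob E P'.
Proof. by move=> PP'; apply: eq_bigl => H; congr andb; apply: asbool_equiv_eq. Qed.

Lemma subset_prob0 E P : (forall H, ~ P H) -> subset_prob E P = 0.
Proof. by move=> nP; apply: big1 => H /andP[_ /asboolP/nP]. Qed.

(** The union bound; it will range over Client's answers to one offer. *)
Lemma subset_prob_bigU E P (I : finType) (Q : {set I}) (P' : I -> {set T} -> Prop) :
  (forall H, P H -> exists2 i, i \in Q & P' i H) ->
  subset_prob E P <= \sum_(i in Q) subset_prob E (P' i).
Proof.
move=> PQ; rewrite /subset_prob.
rewrite big_mkcondr /= (eq_bigr (fun i => \sum_(H : {set T} | H \subset E)
  (if `[< P' i H >] then p ^+ #|H| * (1 - p) ^+ #|E :\: H| else 0))); last first.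
  by move=> i _; rewrite big_mkcondr.
rewrite exchange_big; apply: ler_sum => H HE.
case: asboolP => [/PQ[i iQ PiH]|_]; last first.
  by apply: sumr_ge0 => i _; case: ifP.
rewrite (bigD1 i) //=; case: asboolP => // _.
by rewrite lerDl; apply: sumr_ge0 => j _; case: ifP.
Qed.

Lemma subset_prob_split E P e : e \in E ->
  subset_prob E P = (1 - p) * subset_prob (E :\ e) P +
                    p * subset_prob (E :\ e) (fun H => P (e |: H)).
Proof.
move=> eE; rewrite /subset_prob (bigID (fun H => e \in H)) /= addrC; congr (_ + _).
  rewrite mulr_sumr; apply: eq_big => H.
    by rewrite subsetD1 andbAC.
  move=> /andP[/andP[_ _] eH]; rewrite mulrCA -exprS; congr (_ * _ ^+ _).
  rewrite (cardsD1 e) !inE eE eH add1n; congr (_.+1).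
  by apply: eq_card => x; rewrite !inE andbCA.
rewrite mulr_sumr (reindex_onto (fun H => e |: H) (fun H => H :\ e)) /=; last first.
  by move=> H /andP[_ eH]; rewrite setD1K.
apply: eq_big => H.
  rewrite setU11 andbT subUset sub1set eE subsetD1 andTb andbAC; congr (_ && _ && _).
  apply/eqP/idP => [<-|eH]; first by rewrite setD11.
  by rewrite setU1K.
case/andP => _ /eqP He.
have eH : e \notin H by rewrite -He setD11.
rewrite cardsU1 eH add1n exprS -mulrA; congr (_ * (_ * _ ^+ _)).
by apply: eq_card => x; rewrite !inE negb_or andbA [(_ \notin H) && _]andbC.
Qed.

Lemma subset_probT E : subset_prob E (fun=> True) = 1.
Proof.
elim: {E}_.+1 {-2}E (ltnSn #|E|) => // n IH E En.
have [->|[e eE]] := set_0Vmem E.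
  rewrite /subset_prob (big_pred1 set0) ?cards0 ?set0D ?cards0 ?mulr1 //.
  by move=> H; rewrite subset0; case: asboolP => // _; rewrite andbT.
rewrite (subset_prob_split _ eE) !IH; first by ring.
all: by move: En; rewrite (cardsD1 e) eE.
Qed.

Lemma subset_prob_le1 E P : subset_prob E P <= 1.
Proof.
rewrite -(subset_probT E) /subset_prob [leRHS]big_mkcondr [leLHS]big_mkcondr /=.
apply: ler_sum => H _; case: asboolP => _; last by case: ifP.
by case: asboolP.
Qed.

Lemma subset_probC E P : subset_prob E P = 1 - subset_prob E (fun H => ~ P H).
Proof.
apply/eqP; rewrite eq_sym subr_eq -[eqbLHS](subset_probT E) {1}/subset_prob.
rewrite (bigID (fun H => `[< P H >])); apply/eqP; congr (_ + _); apply: eq_bigl => H.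
  by case: (asboolP True) => // _; rewrite andbT.
by rewrite asbool_neg; case: (asboolP True) => // _; rewrite andbT.
Qed.

End RandomSubset.

Section Exposure.
Variables (R : realFieldType) (T : finType) (p : R) (b m K : nat) (G : {set edge T}).
Hypotheses (p01 : 0 <= p <= 1) (T2 : (2 < #|T|)%N) (m0 : (0 < m)%N).
Hypothesis Km : (2 * K <= m.+1 ^ 2)%N.
Implicit Types (A C E Q U H X : {set edge T}).

(** [A] holds the exposed edges found present and [H] the random edges not yet exposed, so [G :|: A]
    is the part of the board known to Waiter. *)
Definition fails A U C H : Prop :=
  ~ forces b (G :|: (A :|: H)) (hamilton_cycles (G :|: (A :|: H))) U C.

Lemma fails_offer A U C Q H : Q \subset (G :|: A) :\: U -> #|Q| = b.+1 -> fails A U C H ->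
  exists2 e, e \in Q & fails A (U :|: Q) (e |: C) H.
Proof.
move=> sQ cQ nf; apply/not_exists2P => h; apply: nf; apply: (ForcesOffer (Q := Q)) => //.
  by apply: subset_trans sQ _; rewrite setSD // setUA subsetUl.
move=> x xQ; apply: contrapT => nf.
by case: (h x).
Qed.

(* A path has at most [#|T|] vertices, hence [r] boosters make [C] Hamiltonian. *)
Definition near_hamiltonian C r : Prop :=
  hamiltonian (adj C) \/
  exists k, [/\ (0 < k)%N, has_path (adj C) k & (#|T| < k + r)%N].

Lemma near_hamiltonian_booster C r k e : longest_path (adj C) k -> (#|T| < k + r)%N ->
  booster_edge C k e -> near_hamiltonian (e |: C) r.-1.
Proof.
move=> [hk _] kr [hC|[j kj hj]]; [by left|right]; exists j.
have := has_path_le hk; split=> //; lia.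
Qed.

(** Client's graph has at least [K] boosters, and fewer than [K] edges are already offered or
    exposed, so a fresh booster remains. *)
Lemma near_hamiltonian_booster_exists C E U r : expander (adj C) m ->
  near_hamiltonian C r -> ~ hamiltonian (adj C) -> (#|U :|: ~: E| < K)%N ->
  [/\ (0 < r)%N & exists e, [/\ e \in E, e \notin U & near_hamiltonian (e |: C) r.-1]].
Proof.
move=> exC [//|[k [k0 hk kr]]] _ UE.
have [j kj lj] := longest_path_exists hk.
have jr : (#|T| < j + r)%N by lia.
have r0 : (0 < r)%N by rewrite -(ltn_add2l j) addn0 (leq_ltn_trans (has_path_le lj.1) jr).
have := card_booster_edges m0 exC lj (leq_trans k0 kj).
set B := [set e | _] => cB.
have : (0 < #|B :\: (U :|: ~: E)|)%N.
  rewrite cardsD subn_gt0; apply: leq_ltn_trans (subset_leq_card (subsetIr _ _)) _.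
  rewrite -(ltn_pmul2l (isT : (0 < 2)%N)); apply: leq_trans cB.
  by apply: leq_trans Km; rewrite ltn_pmul2l.
case/card_gt0P => e; rewrite !inE negb_or negbK => /andP[/andP[eU eE] /asboolP be].
by split=> //; exists e; split=> //; apply: near_hamiltonian_booster be.
Qed.

(* Waiter looks one by one at edges of [E] that are boosters of Client's graph
   [C], collects those that turn out to be present in [Q], and offers [Q] when
   it has [b + 1] elements. The factor [b + 1] per offer is the union bound
   over Client's answers, and the expectation of [2 ^ - found edges] over [N]
   looks is [(1 - p / 2) ^ N]. *)
Lemma exposure_bound N : forall E A U C Q r,
  expander (adj C) m -> near_hamiltonian C r -> C \subset G :|: A ->
  Q \subset A :\: U -> Q \subset ~: E -> (#|Q| <= b)%N ->
  (forall e, e \in Q -> near_hamiltonian (e |: C) r.-1) ->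
  (#|U :|: ~: E| + N <= K)%N ->
  subset_prob p E (fails A U C) <=
    b.+1%:R ^+ r * 2 ^+ (r * b.+1 - #|Q|) * (1 - p / 2) ^+ N.
Proof.
have b1 : 1 <= b.+1%:R :> R by rewrite ler1n.
case/andP: (p01) => p0 p1.
have q0 : 0 <= 1 - p / 2 by lra.
elim: N => [|N IH] E A U C Q r exC nC CA QA QE Qb Qn UE.
  apply: le_trans (subset_prob_le1 p01 _ _) _.
  by rewrite mulr1 mulr_ege1 // exprn_ege1 // ler1n.
case: (pselect (hamiltonian (adj C))) => [hC|nhC].
  rewrite subset_prob0; first by rewrite !mulr_ge0 ?exprn_ge0 // ler0n.
  move=> H; apply; have CX : C \subset G :|: (A :|: H).
    by rewrite setUA; apply: subset_trans CA (subsetUl _ _).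
  by have [F FW FC] := hamilton_cycle_exists T2 CX hC; apply: ForcesDone FW FC.
have [|r0 [e [eE eU ne]]] := near_hamiltonian_booster_exists (E := E) (U := U) exC nC nhC.
  by lia.
have eQ : e \notin Q by apply: contraL eE => /(subsetP QE); rewrite inE.
rewrite (subset_prob_split p _ eE).
set X := b.+1%:R ^+ r * 2 ^+ (r * b.+1 - #|Q|) * (1 - p / 2) ^+ N.
have rQ : (#|Q| < r * b.+1)%N.
  by apply: leq_ltn_trans Qb _; rewrite -(prednK r0) mulSn addSn ltnS leq_addr.
have cE : (#|U :|: ~: (E :\ e)| <= #|U :|: ~: E|.+1)%N.
  have -> : U :|: ~: (E :\ e) = e |: (U :|: ~: E).
    by rewrite setCD setUA setUC.
  by rewrite cardsU1; case: (_ \notin _).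
have UE' : (#|U :|: ~: (E :\ e)| + N <= K)%N.
  by apply: leq_trans UE; rewrite addnS -addSn leq_add2r.
have QE' : Q \subset ~: (E :\ e).
  by apply: subset_trans QE _; rewrite setCS subsetDl.
have H1 : subset_prob p (E :\ e) (fails A U C) <= X by apply: IH.
pose Q' := e |: Q; pose A' := e |: A.
have cQ' : #|Q'| = #|Q|.+1 by rewrite cardsU1 eQ.
have Q'E : Q' \subset ~: (E :\ e).
  by rewrite subUset sub1set QE' andbT !inE eqxx.
have Q'A : Q' \subset A' :\: U.
  rewrite subUset sub1set !inE eU eqxx /=.
  by apply: subset_trans QA _; rewrite setSD // subsetUr.
have CA' : C \subset G :|: A'.
  by apply: subset_trans CA _; rewrite setUS // subsetUr.
have Q'n f : f \in Q' -> near_hamiltonian (f |: C) r.-1.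
  by rewrite in_setU1 => /orP[/eqP->|/Qn].
have H2 : subset_prob p (E :\ e) (fun H => fails A U C (e |: H)) <= X / 2.
  rewrite (@eq_subset_prob _ _ _ _ _ (fails A' U C)); last first.
    move=> H; rewrite /fails.
    by have -> : A :|: (e |: H) = A' :|: H by rewrite setUCA setUA.
  have -> : X / 2 = b.+1%:R ^+ r * 2 ^+ (r * b.+1 - #|Q|.+1) * (1 - p / 2) ^+ N.
    rewrite /X -(subnSK rQ) exprS; move: (_ ^+ r) (2 ^+ _) (_ ^+ N) => x y z; by field.
  case: (ltnP #|Q| b) => Qb'.
    have := IH (E :\ e) A' U C Q' r; rewrite cQ'; exact.
  (* A full batch is offered: the union bound costs a factor [b.+1], which lowering [r] pays for,
     and the next batch starts empty. The offered edges are exposed already, so the count against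
     [K] does not grow. *)
  have Qeq : #|Q| = b by apply/eqP; rewrite eqn_leq Qb.
  have cQ : #|Q'| = b.+1 by rewrite cQ' Qeq.
  apply: le_trans (subset_prob_bigU p01 _ (Q := Q')
    (P' := fun f => fails A' (U :|: Q') (f |: C)) _) _.
    move=> H; apply: fails_offer => //.
    by apply: subset_trans Q'A _; rewrite setSD // subsetUr.
  have step f : f \in Q' -> subset_prob p (E :\ e) (fails A' (U :|: Q') (f |: C)) <=
      b.+1%:R ^+ r.-1 * 2 ^+ (r.-1 * b.+1 - #|set0 : {set edge T}|) * (1 - p / 2) ^+ N.
    move=> fQ; apply: IH.
    - by apply: expanderS exC; apply: subsetUr.
    - exact: Q'n.
    - rewrite subUset CA' andbT sub1set inE.
      by move: (subsetP Q'A _ fQ); rewrite inE => /andP[_ ->]; rewrite orbT.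
    - exact: sub0set.
    - exact: sub0set.
    - by rewrite cards0.
    - by move=> ?; rewrite inE.
    - by rewrite -setUA (setUidPr Q'E).
  apply: le_trans (ler_sum _ step) _.
  rewrite sumr_const cQ cards0 subn0 Qeq -[leLHS]mulr_natl.
  have -> : (r * b.+1 - b.+1)%N = (r.-1 * b.+1)%N by rewrite -{1}(prednK r0) mulSn addKn.
  have -> : b.+1%:R ^+ r = b.+1%:R * b.+1%:R ^+ r.-1 :> R by rewrite -exprS prednK.
  by rewrite !mulrA.
(* One look multiplies the bound by [(1 - p) + p / 2]. *)
have -> : b.+1%:R ^+ r * 2 ^+ (r * b.+1 - #|Q|) * (1 - p / 2) ^+ N.+1 =
  (1 - p) * X + p * (X / 2).
  by rewrite exprS /X; move: (_ ^+ r) (2 ^+ _) (_ ^+ N) => x y z; by field.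
by rewrite lerD // ler_wpM2l // subr_ge0.
Qed.

End Exposure.

(** * Forcing an expander *)

Section Degrees.
Variable T : finType.
Implicit Types (U Q H : {set edge T}) (v w x : T).

Lemma set2_injr v w w' : v != w -> [set v; w] = [set v; w'] -> w = w'.
Proof. by move=> vw /set2_inj[] [? ?]; subst => //; rewrite eqxx in vw. Qed.

Lemma degree_adj H v : (degree H v <= #|[set w | adj H v w]|)%N.
Proof.
rewrite /degree -(card_imset _ (@val_inj _ _ (edge T))).
apply: leq_trans (leq_imset_card (fun w => [set v; w]) _).
apply: subset_leq_card; apply/subsetP => A /imsetP[e]; rewrite inE => /andP[eH ve] ->.
have /cards2P[x [y [xy Exy]]] := valP e.
move: ve; rewrite Exy !inE => /orP[] /eqP Ev; apply/imsetP.
  exists y; last by rewrite Ev.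
  by rewrite inE; apply/adjP; exists e; rewrite // Exy Ev.
exists x; last by rewrite Ev setUC.
by rewrite inE; apply/adjP; exists e; rewrite // Exy Ev setUC.
Qed.

Lemma degreeD H U v : U \subset H -> degree (H :\: U) v = (degree H v - degree U v)%N.
Proof.
move=> UH; rewrite /degree.
have -> : [set e in H :\: U | v \in val e] =
    [set e in H | v \in val e] :\: [set e in U | v \in val e].
  by apply/setP => e; rewrite !inE; case: (e \in U); case: (v \in _); rewrite ?andbF ?andbT.
rewrite cardsD (setIidPr _) //; apply/subsetP => e; rewrite !inE => /andP[eU ->].
by rewrite (subsetP UH).
Qed.

Lemma degreeU U Q v : (degree (U :|: Q) v <= degree U v + degree Q v)%N.
Proof.
rewrite /degree; apply: leq_trans (leq_card_setU _ _).
by apply: subset_leq_card; apply/subsetP => e; rewrite !inE andb_orl.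
Qed.

Lemma sum_degree U : (\sum_v degree U v = 2 * #|U|)%N.
Proof.
transitivity (\sum_(v : T) \sum_(e in U) (v \in val e : nat))%N.
  apply: eq_bigr => v _; rewrite /degree -sum1_card big_mkcond [RHS]big_mkcond /=.
  by apply: eq_bigr => e _; rewrite !inE; case: (e \in U) => //=; case: (v \in _).
rewrite exchange_big /= mulnC -sum_nat_const; apply: eq_bigr => e _.
by transitivity #|val e|; [rewrite -sum1_card [RHS]big_mkcond|exact: eqP (valP e)].
Qed.

Definition star H v (D : {set T}) : {set edge T} :=
  [set e in H | [exists w in D, val e == [set v; w]]].

Lemma card_star H v (D : {set T}) : {in D, forall w, adj H v w} -> #|star H v D| = #|D|.
Proof.
move=> aD; rewrite -(card_imset _ (@val_inj _ _ (edge T))).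
rewrite -(@card_in_imset _ _ (fun w => [set v; w]) (mem D)); last first.
  by move=> w w' wD _; apply: set2_injr; apply: adj_neq (aD _ wD).
apply: eq_card => /= A; apply/imsetP/imsetP => [[e]|[w wD ->]].
  by rewrite inE => /andP[_ /existsP[w /andP[wD /eqP ve]]] ->; exists w.
have /adjP[e eH ve] := aD _ wD; exists e => //.
by rewrite inE eH; apply/existsP; exists w; rewrite wD ve eqxx.
Qed.

Lemma degree_star H v D w : w != v -> (degree (star H v D) w <= (w \in D))%N.
Proof.
move=> wv; rewrite /degree -(card_imset _ (@val_inj _ _ (edge T))).
case: (boolP (w \in D)) => wD.
  apply: leq_trans (_ : #|[set [set v; w]]| <= 1)%N; last by rewrite cards1.
  apply: subset_leq_card; apply/subsetP => A /imsetP[e].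
  rewrite !inE => /andP[/andP[_ /existsP[x /andP[_ /eqP ve]]]]; rewrite ve !inE.
  by rewrite (negbTE wv) /= => /eqP -> ->.
rewrite leqn0 cards_eq0; apply/eqP/setP => A; rewrite inE; apply/imsetP => -[e].
rewrite !inE => /andP[/andP[_ /existsP[x /andP[xD /eqP ve]]]]; rewrite ve !inE.
by rewrite (negbTE wv) /= => /eqP wx; rewrite wx xD in wD.
Qed.

Lemma superset_of_card (A : {set T}) k : (#|A| <= k <= #|T|)%N ->
  exists2 Z : {set T}, A \subset Z & #|Z| = k.
Proof.
case/andP => Ak kT.
have [|B sB cB] := @subset_of_card _ (~: A) (k - #|A|).
  by rewrite -(cardsC A) leq_subLR in kT *.
exists (A :|: B); first exact: subsetUl.
rewrite cardsU cB (_ : A :&: B = set0) ?cards0 ?subn0 ?subnKC //.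
by apply/setP => x; rewrite !inE; apply/andP => -[xA /(subsetP sB)]; rewrite inE xA.
Qed.

End Degrees.

(** * A potential for failures of expansion *)

Section Potential.
Variables (R : realFieldType) (T : finType) (m M : nat).
Hypothesis M0 : (0 < M)%N.
Implicit Types (C : {set edge T}) (r : seq T) (P : {set T} * {set T}).

(** A set S with at most 2|S| outer neighbours fits together with them into a set Z of exactly 3|S|
    vertices, if there are that many. *)
Definition trap_pair P := (0 < #|P.1| <= m)%N && (#|P.2| == 3 * #|P.1|)%N.

Definition trapped C P := [forall x in P.1, forall y, adj C x y ==> (y \in P.2)].

Lemma trappedP C P :
  reflect (forall x y, x \in P.1 -> adj C x y -> y \in P.2) (trapped C P).
Proof.
apply: (iffP forall_inP) => [h x y xP|h x xP].
  by move/forallP: (h x xP) => /(_ y)/implyP.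
by apply/forallP => y; apply/implyP; apply: h.
Qed.

(** A uniform choice among at least [M] candidates hits a given set of [3 * k] vertices with
    probability at most 3k/M; the weight doubles this for Markov's inequality. *)
Definition trap_weight k : R := (6 * k)%:R / M%:R.

Let q_ge0 k : 0 <= trap_weight k.
Proof. by rewrite divr_ge0. Qed.

(* The elements [v] of [r] are the rounds still to be played, in which Client
   will receive an edge at [v]. [potential] is the expected number of pairs
   (S, Z) with N(S) inside Z, if the other end of such an edge were in Z with
   probability [trap_weight #|S|]. *)
Definition potential C r : R :=
  \sum_(P | trap_pair P) (trapped C P)%:R * trap_weight #|P.1| ^+ count (mem P.1) r.

(** A set that fails to expand is trapped in some Z, and with no round left this pair alone
    contributes 1. *)
Lemma potential_expander C : (3 * m <= #|T|)%N ->
  potential C [::] < 1 -> expander (adj C) m.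
Proof.
move=> mT; rewrite ltNge; apply: contraNP => /existsNP[S] /not_implyP[Sm].
move/negP; rewrite -leqNgt => NS.
have [|Z sZ cZ] := @superset_of_card _ (S :|: nbhd (adj C) S) (3 * #|S|).
  apply/andP; split; last by apply: leq_trans mT; rewrite leq_mul2l /=; case/andP: Sm.
  have -> : S :|: nbhd (adj C) S = S :|: (nbhd (adj C) S :\: S).
    by apply/setP => x; rewrite in_setU in_setU in_setD; case: (x \in S).
  by apply: leq_trans (leq_card_setU _ _) _; rewrite mulSn leq_add2l.
rewrite /potential (bigD1 (S, Z)) /=; last by rewrite /trap_pair /= cZ eqxx andbT.
rewrite mulr1 (_ : trapped _ _) ?lerDl; last first.
  apply/trappedP => x y /= xS a; apply: (subsetP sZ); rewrite !inE.
  by apply/orP; right; apply/existsP; exists x; rewrite xS.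
by apply: sumr_ge0 => P _; rewrite mulr_ge0 ?exprn_ge0.
Qed.

(* Markov's inequality for a random [w] in [D]. *)
Lemma potential_step C v r (D : {set T}) : (M <= #|D|)%N ->
  exists2 D' : {set T}, D' \subset D & (2 * #|D :\: D'| < M)%N /\
    forall w C', w \in D' -> C \subset C' -> adj C' v w ->
      potential C' r <= potential C (v :: r).
Proof.
move=> MD.
pose c P : R := (trapped C P)%:R * trap_weight #|P.1| ^+ count (mem P.1) r.
have c_ge0 P : 0 <= c P by rewrite mulr_ge0 ?exprn_ge0.
(* [F] and [g] split the old potential by whether [v] lies in S. With [w] as a neighbour of [v], at
   most [f w] takes the place of [F], and the part [g] does not increase. *)
pose f w := \sum_(P | trap_pair P && (v \in P.1)) c P * (w \in P.2)%:R.
pose F := \sum_(P | trap_pair P && (v \in P.1)) c P * trap_weight #|P.1|.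
pose g := \sum_(P | trap_pair P && (v \notin P.1)) c P.
have F_ge0 : 0 <= F by apply: sumr_ge0 => P _; rewrite mulr_ge0.
have sumf : \sum_(w in D) f w <= F * M%:R / 2.
  rewrite exchange_big /= !mulr_suml.
  apply: ler_sum => P /andP[/andP[_ /eqP cP] _].
  rewrite -mulr_sumr (_ : c P * _ * _ / 2 = c P * (3 * #|P.1|)%:R); last first.
    move: (c P) => cc.
    by rewrite /trap_weight !natrM; field; rewrite pnatr_eq0 -lt0n.
  rewrite ler_wpM2l //.
  rewrite -natr_sum ler_nat -cP -sum1_card [leqRHS]big_mkcond /=.
  rewrite big_mkcond; apply: leq_sum => w _; by case: (w \in D).
exists [set w in D | f w <= F]; first by apply/subsetP => w; rewrite inE => /andP[].
split.
  set B := D :\: _.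
  have BF w : w \in B -> F < f w.
    by rewrite !inE => /andP[h wD]; rewrite wD /= -ltNge in h.
  have [->|[w0 w0B]] := set_0Vmem B; first by rewrite cards0.
  have : #|B|%:R * F < F * M%:R / 2.
    apply: lt_le_trans sumf; apply: lt_le_trans (_ : \sum_(w in B) f w <= _).
      rewrite mulr_natl -sumr_const; apply: ltr_sum => //.
      by apply/hasP; exists w0; rewrite // mem_index_enum.
    rewrite [leRHS](big_setID B) /= (setIidPr _) ?subsetDl // lerDl.
    by apply: sumr_ge0 => w _; apply: sumr_ge0 => P _; rewrite mulr_ge0.
  move=> h; rewrite ltnNge; apply/negP; rewrite -(ler_nat R) natrM => /(ler_wpM2l F_ge0).
  move: h; move: (#|B|%:R : R) (M%:R : R) (F : R) => x y z; lra.
move=> w C'; rewrite inE => /andP[_ fw] CC' a.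
have -> : potential C (v :: r) = F + g.
  rewrite /potential (bigID (fun P => v \in P.1)) /=.
  congr (_ + _); apply: eq_bigr => P /andP[_ h].
    by rewrite h add1n exprSr mulrA.
  by rewrite (negbTE h) add0n.
apply: le_trans (_ : f w + g <= _); last by rewrite lerD2r.
rewrite /potential (bigID (fun P => v \in P.1)) /=.
apply: lerD; apply: ler_sum => P /andP[_ h].
  rewrite /c mulrAC ler_wpM2r ?exprn_ge0 // -natrM mulnb ler_nat.
  case: trappedP => // tC'; rewrite (tC' _ _ h a) andbT.
  case: trappedP => // -[] x y xP axy; exact: tC' xP (adjS CC' axy).
rewrite /c ler_wpM2r ?exprn_ge0 // ler_nat.
case: trappedP => // tC'.
case: trappedP => // -[] x y xP axy; exact: tC' xP (adjS CC' axy).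
Qed.

End Potential.

Section ExpanderStage.
Variables (R : realFieldType) (T : finType) (p : R) (b m M L : nat) (G : {set edge T}).
Hypotheses (p01 : 0 <= p <= 1) (M0 : (0 < M)%N).
Hypothesis degG : forall v, (3 * M + 5 * b.+1 <= degree G v)%N.
Hypothesis bM : (2 * b.+1 <= M)%N.
Hypothesis LM : (2 * L < M.+1 * M)%N.
Implicit Types (C U : {set edge T}) (r : seq T).

(** At most [M] vertices have degree at least [M] in [U], by the degree sum and [LM]; [degG] leaves
    [v] at least [2 * M] unoffered edges. *)
Lemma candidates_card U v k : U \subset G -> (degree U v <= M + b.+1 * (5 - k.+1))%N ->
  (#|U| <= L)%N ->
  (M <= #|[set w | adj (G :\: U) v w && (degree U w < M)]|)%N.
Proof.
move=> UG dU UL.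
pose N := [set w | adj (G :\: U) v w]; pose O := [set w | M <= degree U w]%N.
have cO : (#|O| <= M)%N.
  rewrite leqNgt; apply/negP => MO; move: LM; rewrite ltnNge => /negP; apply.
  apply: leq_trans (_ : #|O| * M <= _)%N; first by rewrite leq_mul2r MO orbT.
  apply: leq_trans (_ : 2 * #|U| <= _)%N; last by rewrite leq_mul2l UL.
  rewrite -sum_degree -sum_nat_const big_mkcond /=; apply: leq_sum => w _.
  by case: ifP; rewrite ?inE.
have cN : (2 * M <= #|N|)%N.
  apply: leq_trans (degree_adj _ _); rewrite degreeD //.
  have := degG v; move: (degree G v) (degree U v) dU => x y; nia.
have -> : [set w | adj (G :\: U) v w && (degree U w < M)%N] = N :\: O.
  by apply/setP => w; rewrite !inE ltnNge andbC.
rewrite cardsD; have := subset_leq_card (subsetIr N O).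
move: (#|N|) (#|O|) (#|_ :&: _|) cN cO => x y z; lia.
Qed.

(* Waiter offers [b + 1] edges at the first vertex of [r]; their other ends
   have small degree in [U], so that no vertex runs out of unoffered edges
   before its own rounds. *)
Lemma expander_stage (delta : R) :
  (forall U C, C \subset G -> (#|U| <= L)%N -> potential R m M C [::] < 1 ->
     subset_prob p setT (fails b G set0 U C) <= delta) ->
  forall r U C, U \subset G -> C \subset G ->
    (forall v, count_mem v r <= 5)%N ->
    (forall v, degree U v <= M + b.+1 * (5 - count_mem v r))%N ->
    (#|U| + size r * b.+1 <= L)%N -> potential R m M C r < 1 ->
    subset_prob p setT (fails b G set0 U C) <= b.+1%:R ^+ size r * delta.
Proof.
move=> base; elim=> [|v r IH] U C UG CG r5 dU UL pot.
  by rewrite expr0 mul1r; apply: base; rewrite // -(addn0 #|U|).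
have UL' : (#|U| <= L)%N by apply: leq_trans UL; apply: leq_addr.
have dUv : (degree U v <= M + b.+1 * (5 - (count_mem v r).+1))%N.
  by have := dU v; rewrite /= eqxx.
set D := [set w | adj (G :\: U) v w && (degree U w < M)%N].
have MD := candidates_card UG dUv UL'; rewrite -/D in MD.
have [D' D'D [cD' potD']] := potential_step R m M0 C v r MD.
(* Fewer than M/2 of the at least [M] candidates are discarded, which leaves [b.+1] of them. *)
have [|D1 D1D' cD1] := @subset_of_card _ D' b.+1.
  move: cD'; rewrite cardsD (setIidPr D'D); have := subset_leq_card D'D.
  move: (#|D|) (#|D'|) MD bM => x y; lia.
have adjD1 : {in D1, forall w, adj (G :\: U) v w}.
  by move=> w /(subsetP D1D') /(subsetP D'D); rewrite inE => /andP[].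
set Q := star (G :\: U) v D1.
have cQ : #|Q| = b.+1 by rewrite card_star.
have QGU : Q \subset G :\: U by apply/subsetP => e; rewrite inE => /andP[].
have QG : Q \subset G by apply: subset_trans QGU (subsetDl _ _).
apply: le_trans (subset_prob_bigU p01 _ (Q := Q)
  (P' := fun e => fails b G set0 (U :|: Q) (e |: C)) _) _.
  by move=> H; apply: fails_offer; rewrite ?setU0.
rewrite exprS -mulrA.
have -> : b.+1%:R * (b.+1%:R ^+ size r * delta) = \sum_(e in Q) b.+1%:R ^+ size r * delta.
  by rewrite sumr_const cQ -[RHS]mulr_natl.
apply: ler_sum => e eQ; apply: IH.
- by rewrite subUset UG.
- by rewrite subUset CG andbT sub1set (subsetP QG).
- by move=> w; apply: leq_trans (r5 w); rewrite /= leq_addl.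
(* The degree of [v] may grow by [b.+1] since its count drops. Another vertex gains at most one
   edge, and only if its degree was below [M]. *)
- move=> w; apply: leq_trans (degreeU _ _ _) _.
  have [->|wv] := eqVneq w v.
    have dQ : (degree Q v <= b.+1)%N.
      by rewrite -cQ; apply: subset_leq_card; apply/subsetP => f; rewrite inE => /andP[].
    have := r5 v; rewrite /= eqxx add1n => c5.
    apply: leq_trans (leq_add dUv dQ) _; rewrite -addnA leq_add2l -mulnSr leq_mul2l.
    by rewrite /= -subSn // subSS.
  have := degree_star (G :\: U) D1 wv; rewrite -/Q.
  have := dU w; rewrite /= eq_sym (negbTE wv) add0n.
  case: (boolP (w \in D1)) => wD1 dUw dQ; last first.
    by rewrite -[leqRHS]addn0; apply: leq_add.
  move: wD1 => /(subsetP D1D') /(subsetP D'D); rewrite inE => /andP[_ dM].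
  apply: leq_trans (leq_addr _ _).
  by apply: leq_trans dM; rewrite -[leqRHS]addn1 leq_add2l.
- apply: leq_trans UL; rewrite /= mulSn addnA leq_add2r.
  by apply: leq_trans (leq_card_setU _ _) _; rewrite cQ.
apply: le_lt_trans pot.
move: eQ; rewrite inE => /andP[_ /existsP[w /andP[wD1 /eqP ve]]].
apply: (potD' w); first exact: (subsetP D1D').
- exact: subsetUr.
by apply/adjP; exists e; rewrite ?setU11.
Qed.

Lemma potential_start : 
  potential R m M (set0 : {set edge T}) (flatten (nseq 5 (enum T))) =
  \sum_(P : {set T} * {set T} | trap_pair m P) trap_weight R M #|P.1| ^+ (5 * #|P.1|).
Proof.
apply: eq_bigr => P _.
have -> : trapped (set0 : {set edge T}) P by apply/trappedP => x y _ /adjP[e]; rewrite inE.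
rewrite mul1r; congr (_ ^+ _).
have cE : count (mem P.1) (enum T) = #|P.1| by rewrite cardE -size_filter enumT.
by rewrite /= !cats0 !count_cat cE !mulSn mul0n addn0.
Qed.

End ExpanderStage.

(** * Choice of the parameters *)

Section BinomialBounds.
Local Open Scope nat_scope.

Lemma ffact_le_exp n k : n ^_ k <= n ^ k.
Proof.
rewrite ffact_prod; apply: leq_trans (_ : \prod_(i < k) n <= _).
  by apply: leq_prod => i _; apply: leq_subr.
by rewrite prod_nat_const card_ord.
Qed.

Lemma bin_le_exp2 n k : 'C(n, k) <= 2 ^ n.
Proof.
elim: n k => [|n IH] [|k]; rewrite ?bin0 ?expn_gt0 //.
by rewrite binS expnS mul2n -addnn leq_add.
Qed.

(** A weak Stirling bound: [k ^ k] is at most the falling factorial [(2 * k) ^_ k], a binomial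
    coefficient times the factorial of [k]. *)
Lemma exp_le_fact k : k ^ k <= 4 ^ k * k`!.
Proof.
have h : k ^ k <= (2 * k) ^_ k.
  rewrite ffact_prod -[X in k ^ X]card_ord -prod_nat_const.
  by apply: leq_prod => i _; have := ltn_ord i; lia.
apply: leq_trans h _; rewrite -bin_ffact leq_mul2r -[4]/(2 ^ 2) -expnM.
by rewrite bin_le_exp2 orbT.
Qed.

(** The usual bound (e n / k)^k with 4 in place of e, free of division. *)
Lemma bin_le_exp n k : k ^ k * 'C(n, k) <= (4 * n) ^ k.
Proof.
apply: leq_trans (_ : 4 ^ k * k`! * 'C(n, k) <= _).
  by rewrite leq_mul2r exp_le_fact orbT.
by rewrite -mulnA [k`! * _]mulnC bin_ffact expnMn leq_mul2l ffact_le_exp orbT.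
Qed.

(** The binomials absorb [k ^ k] and [k ^ (3 * k)] out of [k ^ (5 * k)]. What is left compares k n^4
    with M^5, so for M linear in n five rounds per vertex suffice once k is a small fraction of
    n. *)
Lemma trap_count_bound n M k : 0 < k -> 2 * 6 ^ 5 * k * (4 * n) ^ 4 <= M ^ 5 ->
  2 ^ k * ('C(n, k) * 'C(n, 3 * k) * (6 * k) ^ (5 * k)) <= M ^ (5 * k).
Proof.
move=> k0 hM.
have h1 := bin_le_exp n k.
have h3 : k ^ (3 * k) * 'C(n, 3 * k) <= (4 * n) ^ (3 * k).
  apply: leq_trans (bin_le_exp n (3 * k)); rewrite leq_mul2r.
  by rewrite leq_exp2r ?muln_gt0 ?k0 // leq_pmull ?orbT.
have -> : 2 ^ k * ('C(n, k) * 'C(n, 3 * k) * (6 * k) ^ (5 * k)) =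
  (2 * 6 ^ 5 * k) ^ k * ((k ^ k * 'C(n, k)) * (k ^ (3 * k) * 'C(n, 3 * k))).
  rewrite (expnMn 6 k) (expnM 6 5 k); move: (6 ^ 5) => c.
  rewrite !expnMn (_ : k ^ (5 * k) = k ^ k * (k ^ k * k ^ (3 * k))).
    by move: (2 ^ k) (c ^ _) (k ^ k) (k ^ _) ('C(n, k)) ('C(n, _)) => *; ring.
  by rewrite -!expnD; congr (_ ^ _); lia.
rewrite [M ^ _]expnM; move: hM; rewrite -(leq_exp2r _ _ k0); apply: leq_trans.
move: (2 * 6 ^ 5 * k) => c.
rewrite (expnMn c) leq_mul2l -(expnM (4 * n)) (_ : 4 * k = k + 3 * k) //.
by rewrite expnD leq_mul ?orbT.
Qed.

End BinomialBounds.


Section Main.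
Variables (R : realFieldType) (T : finType).

(** Grouped by the size k of S, the pairs weigh at most 2^-k per group, and these bounds sum to less
    than 1. *)
Lemma sum_trap_weight m M : (0 < M)%N ->
  (2 * 6 ^ 5 * m * (4 * #|T|) ^ 4 <= M ^ 5)%N ->
  \sum_(P : {set T} * {set T} | trap_pair m P) trap_weight R M #|P.1| ^+ (5 * #|P.1|) < 1.
Proof.
move=> M0 hM.
pose f k : R := 'C(#|T|, 3 * k)%:R * trap_weight R M k ^+ (5 * k).
have -> : \sum_(P : {set T} * {set T} | trap_pair m P)
      trap_weight R M #|P.1| ^+ (5 * #|P.1|) =
  \sum_(S : {set T} | (0 < #|S| <= m)%N) f #|S|.
  rewrite -(pair_big_dep (fun S : {set T} => (0 < #|S| <= m)%N)
    (fun S Z : {set T} => #|Z| == 3 * #|S|)%N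
    (fun S Z => trap_weight R M #|S| ^+ (5 * #|S|))) /=.
  apply: eq_bigr => S _; rewrite sumr_const -mulr_natl; congr (_%:R * _).
  by rewrite -card_draws cardsE.
have -> : \sum_(S : {set T} | (0 < #|S| <= m)%N) f #|S| =
  \sum_(k < m.+1 | (0 < k)%N) 'C(#|T|, k)%:R * f k.
  rewrite (partition_big (fun S : {set T} => inord #|S| : 'I_m.+1) (fun k => 0 < k)%N).
    apply: eq_bigr => k k0.
    rewrite (eq_big (fun S : {set T} => #|S| == k) (fun=> f k)).
    - by rewrite sumr_const -[LHS]mulr_natl -card_draws cardsE.
    - move=> S; apply/andP/eqP => [[/andP[S0 Sm] /eqP <-]|->]; first by rewrite inordK.
      by rewrite k0 -ltnS ltn_ord inord_val.
    - by move=> S /andP[/andP[S0 Sm] /eqP <-]; rewrite inordK.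
  by move=> S /andP[S0 Sm]; rewrite inordK.
apply: le_lt_trans (_ : \sum_(k < m.+1 | (0 < k)%N) (2^-1 : R) ^+ k < 1).
  apply: ler_sum => k k0; have km : (k <= m)%N by rewrite -ltnS.
  have hk : (2 * 6 ^ 5 * k * (4 * #|T|) ^ 4 <= M ^ 5)%N.
    by apply: leq_trans hM; rewrite leq_mul2r leq_mul2l km !orbT.
  have h := trap_count_bound k0 hk.
  rewrite /f /trap_weight expr_div_n exprVn !mulrA ler_pdivrMr ?exprn_gt0 ?ltr0n //.
  by rewrite ler_pdivlMl ?exprn_gt0 // -!natrX -!natrM ler_nat.
rewrite big_mkcond big_ord_recl /= add0r.
have -> : \sum_(i < m) (2^-1 : R) ^+ (bump 0 i) = 1 - 2^-1 ^+ m.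
  elim: {hM} m => [|m IH]; first by rewrite big_ord0 subrr.
  rewrite big_ord_recr /= IH /bump /= add1n exprS.
  by move: (_ ^+ m) => x; field.
by rewrite ltrBlDr ltrDl exprn_gt0 // invr_gt0.
Qed.

Lemma waiter_fails_bound (p : R) (b m M K N : nat) (G : {set edge T}) :
  0 <= p <= 1 -> (2 < #|T|)%N -> (0 < b)%N -> (0 < m)%N ->
  (forall v, (3 * M + 5 * b.+1 <= degree G v)%N) ->
  (2 * b.+1 <= M)%N -> (2 * (5 * #|T| * b.+1) < M.+1 * M)%N ->
  (2 * 6 ^ 5 * m * (4 * #|T|) ^ 4 <= M ^ 5)%N -> (3 * m <= #|T|)%N ->
  (2 * K <= m.+1 ^ 2)%N -> (5 * #|T| * b.+1 + N <= K)%N ->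
  subset_prob p setT (fun H => ~ waiter_wins b (G :|: H) (hamilton_cycles (G :|: H))) <=
    b.+1%:R ^+ (5 * #|T|) * (b.+1%:R ^+ #|T| * 2 ^+ (#|T| * b.+1) * (1 - p / 2) ^+ N).
Proof.
move=> p01 T2 b0 m0 dG bM LM mM mT Km KN.
have M0 : (0 < M)%N by lia.
apply: le_trans (_ : subset_prob p setT (fails b G set0 set0 set0) <= _).
  rewrite [leRHS](eq_subset_prob _ _ (P' := fun H =>
    ~ forces b (G :|: H) (hamilton_cycles (G :|: H)) set0 set0)); last first.
    by move=> H; rewrite /fails set0U.
  rewrite /subset_prob big_mkcond [leRHS]big_mkcond /=; apply: ler_sum => H _.
  case/andP: (p01) => p0 p1.
  have w0 : 0 <= p ^+ #|H| * (1 - p) ^+ #|[set: edge T] :\: H|.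
    by rewrite mulr_ge0 ?exprn_ge0 ?subr_ge0.
  case: ifP => [/andP[-> /asboolP nw]|_]; last by case: ifP.
  case: asboolP => // h; exfalso; apply: h => f; apply: nw; exact: forces_wins.
have count5 v : count_mem v (flatten (nseq 5 (enum T))) = 5%N.
  by rewrite /= !cats0 !count_cat count_uniq_mem ?enum_uniq // mem_enum.
have size5 : size (flatten (nseq 5 (enum T))) = (5 * #|T|)%N.
  by rewrite /= !cats0 !size_cat -cardE !mulSn mul0n addn0.
have := expander_stage p01 M0 dG bM LM (m := m)
  (delta := b.+1%:R ^+ #|T| * 2 ^+ (#|T| * b.+1) * (1 - p / 2) ^+ N) _
  (r := flatten (nseq 5 (enum T))) (U := set0) (C := set0).
rewrite size5; apply.
- move=> U C CG UL /(potential_expander mT) exC.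
  rewrite -[X in 2 ^+ X]subn0 -[X in (_ - X)%N](cards0 (edge T)).
  apply: (exposure_bound (m := m) (K := K)) => //; rewrite ?sub0set ?cards0 ?setU0 //.
  (* A single vertex is a path, so [r = #|T|] boosters suffice at the start. *)
  + right; exists 1%N; split=> //.
    have /card_gt0P[x _] : (0 < #|T|)%N by lia.
    by exists [:: x].
  + by move=> e; rewrite inE.
  + by rewrite setCT setU0; apply: leq_trans KN; rewrite leq_add2r.
- exact: sub0set.
- exact: sub0set.
- by move=> v; rewrite count5.
- move=> v; rewrite /degree (_ : [set e in _ | _] = set0) ?cards0 //.
  by apply/setP => e; rewrite !inE.
- by rewrite cards0.
by rewrite potential_start; apply: sum_trap_weight.
Qed.

End Main.

From mathcomp Require Import all_classical all_reals all_analysis.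

Import Order.TTheory GRing.Theory Num.Theory.
Import numFieldNormedType.Exports.

Local Open Scope classical_set_scope.
Local Open Scope ring_scope.

(** * Real estimates, constants and convergence *)

Section Asymptotics.
Variable R : realType.

Lemma min_degree_le (T : finType) (G : {set edge T}) v : (min_degree G <= degree G v)%N.
Proof.
rewrite /min_degree; have := mem_index_enum v; elim: (index_enum T) => [//|w s IH].
by rewrite big_cons inE => /orP[/eqP<-|/IH h]; rewrite geq_min ?leqnn ?h ?orbT.
Qed.

Lemma min_degree_le_card (T : finType) (G : {set edge T}) : (min_degree G <= #|T|)%N.
Proof. by rewrite /min_degree; elim/big_rec: _ => // v x _ h; rewrite geq_min h orbT. Qed.

(** The counting factors are at most 2^(8bn), since b + 1 is at most 2^b. As 144 / 2 / 8 = 9, the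
    tail is at most exp(-9bn), and the product is at most exp(-bn). *)
Lemma probability_bound (p e : R) (n b N : nat) :
  0 < e -> (0 < b)%N -> (0 < n)%N -> p <= 1 ->
  144 / e ^+ 2 * b%:R / n%:R <= p -> e ^+ 2 * n%:R ^+ 2 / 8 <= N%:R ->
  b.+1%:R ^+ (5 * n) * (b.+1%:R ^+ n * 2 ^+ (n * b.+1) * (1 - p / 2) ^+ N) <=
    expR (1 *- n) :> R.
Proof.
move=> e0 b0 n0 p1 pb eN.
have b2 : b.+1%:R <= 2 ^+ b :> R by rewrite -natrX ler_nat ltn_expl.
have n_gt0 : 0 < n%:R :> R by rewrite ltr0n.
have b_ge1 : 1 <= b%:R :> R by rewrite ler1n.
have e2 : 2 <= expR 1 :> R by have := expR_ge1Dx (1 : R); lra.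
have powle : b.+1%:R ^+ (5 * n) * (b.+1%:R ^+ n * 2 ^+ (n * b.+1)) <=
    expR (8 * b%:R * n%:R) :> R.
  apply: le_trans (_ : 2 ^+ (b * (5 * n) + b * n + n * b.+1) <= _ ).
    move: (5 * n)%N (n * b.+1)%N => k l.
    rewrite mulrA (exprD _ _ l) (exprD _ (b * k)) (exprM _ b k) (exprM _ b n).
    apply: ler_wpM2r; first exact: exprn_ge0.
    by apply: ler_pM; rewrite ?exprn_ge0 //; apply: lerXn2r; rewrite ?nnegrE ?exprn_ge0.
  apply: le_trans (_ : 2 ^+ (8 * b * n) <= _).
    by rewrite ler_eXn2l ?ltr1n //; nia.
  rewrite -(mulr1 (_ * _ * _)) -[8]/(8%:R) -!natrM expRM_natl.
  by apply: lerXn2r; rewrite ?nnegrE ?expR_ge0.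
have tail : (1 - p / 2) ^+ N <= expR (- (9 * b%:R * n%:R)).
  apply: le_trans (_ : expR (- (p / 2)) ^+ N <= _).
    apply: lerXn2r; rewrite ?nnegrE ?expR_ge0 //; first lra.
    by have := expR_ge1Dx (- (p / 2)).
  rewrite -expRM_natr ler_expR mulNr lerN2.
  apply: le_trans (_ : (144 / e ^+ 2 * b%:R / n%:R) / 2 * (e ^+ 2 * n%:R ^+ 2 / 8) <= _).
    by rewrite le_eqVlt; apply/orP; left; apply/eqP; field; rewrite !gt_eqF.
  apply: ler_pM => //; last by rewrite ler_pM2r ?invr_gt0.
    by do 4![apply: mulr_ge0; rewrite ?invr_ge0 ?ler0n ?exprn_ge0 ?(ltW e0) //].
  by rewrite divr_ge0 // mulr_ge0 ?exprn_ge0 // ltW.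
rewrite mulrA; apply: le_trans (ler_pM _ _ powle tail) _.
- by rewrite !mulr_ge0 ?exprn_ge0 ?ler0n.
- by rewrite exprn_ge0 //; lra.
rewrite -expRD ler_expR.
have : n%:R <= b%:R * n%:R :> R by rewrite ler_peMl // ltW.
rewrite -!mulrA; move: (b%:R * n%:R : R) (n%:R : R) => x y; lra.
Qed.

(* The choice of [eps] that makes each summand of [sum_trap_weight] small. *)
Lemma trap_budget (D alpha e : R) (n m M : nat) :
  0 < D -> 8 ^+ 5 * (2 * 6 ^+ 5 * 4 ^+ 4) <= D -> 0 < alpha -> e = alpha ^+ 5 / D ->
  m%:R <= e * n%:R -> alpha * n%:R / 8 <= M%:R ->
  (2 * 6 ^ 5 * m * (4 * n) ^ 4 <= M ^ 5)%N.
Proof.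
move=> D0 hD a0 He me aM.
set k := (2 * 6 ^ 5 * m * (4 * n) ^ 4)%N.
have Ek : k%:R = 2 * 6 ^+ 5 * 4 ^+ 4 * m%:R * n%:R ^+ 4 :> R.
  rewrite /k (natrM R (2 * 6 ^ 5 * m)) (natrM R (2 * 6 ^ 5)) (natrM R 2) !natrX (natrM R 4).
  by rewrite exprMn mulrACA mulrA.
rewrite -(ler_nat R) Ek natrX {k Ek}.
move: hD; move: (2 * 6 ^+ 5 * 4 ^+ 4) => c hD.
have c0 : c <= D / 8 ^+ 5 by rewrite ler_pdivlMr ?exprn_gt0 // mulrC.
apply: le_trans (_ : (alpha * n%:R / 8) ^+ 5 <= _); last first.
  by apply: lerXn2r; rewrite ?nnegrE ?ler0n // divr_ge0 // mulr_ge0 // ltW.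
apply: le_trans (_ : D / 8 ^+ 5 * (e * n%:R) * n%:R ^+ 4 <= _).
  rewrite ler_wpM2r ?exprn_ge0 //; apply: le_trans (_ : D / 8 ^+ 5 * m%:R <= _).
    by rewrite ler_wpM2r.
  by rewrite ler_wpM2l // divr_ge0 ?exprn_ge0 // ltW.
rewrite He expr_div_n exprMn [n%:R ^+ 5]exprS.
have : (8 ^+ 5 : R) != 0 by rewrite expf_neq0.
move: (8 ^+ 5 : R) (alpha ^+ 5 : R) (n%:R ^+ 4 : R) (n%:R : R) => q x y t q0.
by rewrite le_eqVlt; apply/orP; left; apply/eqP; field; rewrite q0 gt_eqF.
Qed.

Lemma waiter_fails_small (D alpha p : R) (n b : nat) (G : {set edge 'I_n}) :
  let eps := alpha ^+ 5 / D in
  16 <= D -> 8 ^+ 5 * (2 * 6 ^+ 5 * 4 ^+ 4) <= D ->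
  0 < alpha -> 0 <= p <= 1 -> (0 < b)%N -> (2 < n)%N -> 8 / eps ^+ 2 <= n%:R ->
  alpha * n%:R <= (min_degree G)%:R -> b%:R <= eps ^+ 2 / 80 * n%:R ->
  144 / eps ^+ 2 * b%:R / n%:R <= p ->
  subset_prob p (finset.setTfor _) (fun H =>
      ~ waiter_wins b (G :|: H)%SET (hamilton_cycles (G :|: H)%SET)) <=
    expR (1 *- n).
Proof.
move=> eps D1 D2 a0 p01 b0 n2 nbig dG bsmall pb.
have D0 : 0 < D by apply: lt_le_trans D1; rewrite ltr0n.
have budget := trap_budget D0 D2 a0 (erefl eps).
move: D2 => _.
have n0 : (0 < n)%N by apply: leq_trans n2.
have y0 : 0 < n%:R :> R by rewrite ltr0n.
have a1 : alpha <= 1.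
  rewrite -(ler_pM2r y0) mul1r; apply: le_trans dG _; rewrite ler_nat.
  by apply: leq_trans (min_degree_le_card _) _; rewrite card_ord.
have a5 : alpha ^+ 5 <= alpha ^+ 2 by apply: ler_wiXn2l => //; exact: ltW.
have eps0 : 0 < eps by apply: divr_gt0 => //; apply: exprn_gt0.
have eps_a : eps <= alpha ^+ 2 / 16.
  rewrite ler_pdivlMr ?ltr0n // /eps mulrAC ler_pdivrMr //.
  exact: (ler_pM (exprn_ge0 5 (ltW a0)) (ler0n R 16) a5 D1).
move: eps eps0 eps_a nbig bsmall pb budget {a5} => eps eps0 eps_a nbig bsmall pb budget.
have sq_small : alpha ^+ 2 <= alpha by rewrite expr2 ler_piMr // ltW.
have epsn : 8 <= eps ^+ 2 * n%:R by rewrite mulrC -ler_pdivrMr ?exprn_gt0.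
have eps1 : eps <= 1 by lra.
have eps_sq : eps ^+ 2 <= eps by rewrite expr2 ler_piMr // ltW.
have trunc_itv (x : R) : 0 <= x -> (Num.truncn x)%:R <= x /\ x < (Num.truncn x)%:R + 1.
  by move=> /truncn_itv/andP[? ?]; split=> //; rewrite natr1.
have b_ge1 : 1 <= b%:R :> R by rewrite ler1n.
have bS : b.+1%:R <= 2 * b%:R :> R by rewrite -natr1; lra.
have eps_alpha : eps <= alpha / 16 by lra.
have epsn1 : 8 <= eps * n%:R by apply: le_trans epsn _; rewrite ler_pM2r.
have alphan : 128 <= alpha * n%:R.
  by have : eps * n%:R <= alpha / 16 * n%:R by [rewrite ler_pM2r]; lra.
have epsn2 : 8 <= eps ^+ 2 * n%:R ^+ 2.
  apply: le_trans epsn _; rewrite ler_wpM2l ?exprn_ge0 ?(ltW eps0) //.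
  by rewrite expr2 ler_peMr ?ler0n // ler1n.
have bn : b%:R <= alpha ^+ 2 / 1280 * n%:R.
  by apply: le_trans bsmall _; rewrite ler_pM2r //; lra.
have bn' : b%:R <= alpha / 1280 * n%:R.
  by apply: le_trans bn _; rewrite ler_pM2r //; lra.
have ax0 : 0 <= alpha * n%:R / 4 by lra.
(* [M], [m], [K] and [N] are the integer parts of alpha n / 4, eps n, (eps n)^2 / 2 and (eps n)^2 /
   4. *)
have [M1 M2] := trunc_itv _ ax0.
have [m1 m2] := trunc_itv _ (ltW (mulr_gt0 eps0 y0)).
have E0 : 0 <= eps ^+ 2 * n%:R ^+ 2 by lra.
have [K1 K2] := trunc_itv (eps ^+ 2 * n%:R ^+ 2 / 2) (divr_ge0 E0 (ler0n _ 2)).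
have [N1 N2] := trunc_itv (eps ^+ 2 * n%:R ^+ 2 / 4) (divr_ge0 E0 (ler0n _ 4)).
move: (Num.truncn _) M1 M2 => M M1 M2.
move: (Num.truncn _) m1 m2 => m m1 m2.
move: (Num.truncn _) K1 K2 => K K1 K2.
move: (Num.truncn _) N1 N2 => N N1 N2.
have M3 : alpha * n%:R / 8 <= M%:R by lra.
have Ln : n%:R * b.+1%:R <= n%:R * (2 * (eps ^+ 2 / 80 * n%:R)).
  by rewrite ler_pM2l //; apply: le_trans bS _; rewrite ler_pM2l.
have LM : n%:R * b.+1%:R <= n%:R * (2 * (alpha ^+ 2 / 1280 * n%:R)).
  by rewrite ler_pM2l //; apply: le_trans bS _; rewrite ler_pM2l.
have MM : (alpha * n%:R / 4) * (alpha * n%:R / 8) <= (M%:R + 1) * M%:R :> R.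
  apply: ler_pM M3 => //; last exact: ltW.
  by rewrite divr_ge0 // mulr_ge0 // ltW.
have mm : (eps * n%:R) * (eps * n%:R) <= (m%:R + 1) * (m%:R + 1) :> R.
  by apply: ler_pM; rewrite ?mulr_ge0 ?(ltW eps0) // ltW.
have an2 : 0 < alpha ^+ 2 * n%:R ^+ 2 by rewrite mulr_gt0 ?exprn_gt0.
apply: le_trans (@waiter_fails_bound R _ p b m M K N G p01 _ b0 _ _ _ _ _ _ _ _) _.
- by rewrite card_ord.
- by rewrite -(ltr_nat R); clear -epsn1 m2; lra.
- move=> v; apply: leq_trans (min_degree_le G v).
  by rewrite -(ler_nat R) natrD !natrM; clear -M1 bS bn' alphan dG; lra.
- by rewrite -(ler_nat R) natrM; clear -M3 bS bn' alphan; lra.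
- rewrite card_ord -(ltr_nat R) !natrM -(natr1 M).
  by clear -LM MM an2; lra.
- by rewrite card_ord; apply: budget.
- rewrite card_ord -(ler_nat R) natrM.
  have : eps * n%:R <= 1 / 16 * n%:R by rewrite ler_pM2r //; clear -eps_alpha a1; lra.
  by clear -m1 y0; lra.
- by rewrite -(ler_nat R) natrM natrX -natr1; clear -K1 mm; lra.
(* The factor 1/80 keeps 5n(b + 1) below (eps n)^2 / 8. With [N] at most (eps n)^2 / 4, a slack of
   (eps n)^2 / 8, at least 1, remains for rounding [K]. *)
- by rewrite card_ord -(ler_nat R) natrD !natrM; clear -Ln N1 K2 epsn2; lra.
rewrite card_ord; apply: probability_bound pb _ => //; first by case/andP: p01.
by clear -N2 epsn2; lra.
Qed.
End Asymptotics.

Theorem theorem1p6 (R : realType) (alpha : R) (halpha : 0 < alpha) :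
  exists c C : R, [/\ 0 < c, 0 < C &
    forall (G : forall n : nat, {set edge 'I_n}) (b : nat -> nat) (p : nat -> R),
      (\forall n \near \oo,
         [/\ alpha * n%:R <= (min_degree (G n))%:R,
             (0 < b n)%N, (b n)%:R <= c * n%:R,
             C * (b n)%:R / n%:R <= p n & 0 <= p n <= 1]) ->
      Gnp_prob (p n) (fun H : {set edge 'I_n} =>
        waiter_wins (b n) (G n :|: H)%SET (hamilton_cycles (G n :|: H)%SET))
        @[n --> \oo] --> (1 : R)].
Proof.
(* The bound 16 makes [eps] at most [alpha ^+ 2 / 16]; the other bound is what [trap_budget] asks
   for. *)
have [D [D1 D2]] : exists D : R, 16 <= D /\ 8 ^+ 5 * (2 * 6 ^+ 5 * 4 ^+ 4) <= D.
  exists (Num.max 16 (8 ^+ 5 * (2 * 6 ^+ 5 * 4 ^+ 4))).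
  by split; rewrite le_max lexx ?orbT.
pose eps := alpha ^+ 5 / D.
have eps0 : 0 < eps.
  by apply: divr_gt0; [exact: exprn_gt0|apply: lt_le_trans D1; rewrite ltr0n].
exists (eps ^+ 2 / 80), (144 / eps ^+ 2); split.
- by apply: divr_gt0; rewrite ?exprn_gt0.
- by apply: divr_gt0; rewrite ?exprn_gt0.
move=> G b p hyp.
(* The failure probability is at most exp(-n), which gives the lower function of the squeeze. *)
pose f (n : nat) : R := 1 - expR (1 *- n).
apply: (@squeeze_cvgr _ _ _ _ f (fun=> 1)).
- near=> n.
  have [dG b0 bc pb p01] : [/\ alpha * n%:R <= (min_degree (G n))%:R,
      (0 < b n)%N, (b n)%:R <= eps ^+ 2 / 80 * n%:R,
      144 / eps ^+ 2 * (b n)%:R / n%:R <= p n & 0 <= p n <= 1].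
    by near: n.
  rewrite (_ : Gnp_prob _ _ = subset_prob (p n) (finset.setTfor _)
    (fun H : {set edge 'I_n} =>
    waiter_wins (b n) (G n :|: H)%SET (hamilton_cycles (G n :|: H)%SET))); last first.
    by apply: eq_big => H; rewrite ?finset.setTD // finset.subsetT.
  rewrite subset_prob_le1 // andbT subset_probC // lerD2l lerN2.
  have n2 : (2 < n)%N by near: n; exact: nbhs_infty_gt.
  have nbig : 8 / eps ^+ 2 <= n%:R by near: n; exact: nbhs_infty_ger.
  exact: (waiter_fails_small D1 D2 halpha p01 b0 n2 nbig dG bc pb).
- rewrite -[X in _ --> X]subr0; apply: cvgB; first exact: cvg_cst.
  exact: cvgn_expR.
- exact: cvg_cst.
Unshelve. all: by end_near.
Qed.
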